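(* Let $(E,\mathcal F)$ be a matroid without loops, viewed as an interval greedoid whose feasible sets are the independent sets. Then a set $\mathcal L$ of maps $E\to\{0,+,-\}$ is an oriented matroid with underlying matroid $(E,\mathcal F)$ if and only if $(E,\mathcal F,\mathcal L)$ is an oriented interval greedoid.
   Context: A matroid $(E,\mathcal F)$: $E$ finite, $\mathcal F$ a family of subsets (independent sets) closed under taking subsets and satisfying the exchange axiom (if $|X|>|Y|$ there is $x\in X\setminus Y$ with $Y\cup\{x\}\in\mathcal F$); without loops means every singleton is independent. An oriented matroid is a set $\mathcal M$ of maps $E\to\{0,+,-\}$ with: (OM1) the zero map is in $\mathcal M$; (OM2) $\alpha\in\mathcal M\Rightarrow-\alpha\in\mathcal M$; (OM3) $\alpha,\beta\in\mathcal M\Rightarrow\alpha\circ\beta\in\mathcal M$, where $(\alpha\circ\beta)(e)=\alpha(e)$ if $\alpha(e)\neq0$ and $\beta(e)$ otherwise; (OM4) for $\alpha,\beta\in\mathcal M$ and each $e\in S(\alpha,\beta)=\{e:\alpha(e)=-\beta(e)\neq0\}$ there is $\gamma\in\mathcal M$ with $\gamma(e)=0$ and $\gamma(f)=(\alpha\circ\beta)(f)=(\beta\circ\alpha)(f)$ for all $f\notin S(\alpha,\beta)$. The zero sets of elements of $\mathcal M$ are the closed sets of a matroid, its underlying matroid. Interval greedoid: finite $E$ and nonempty family $\mathcal F$ with (IG1) every nonempty $X\in\mathcal F$ has $x$ with $X\setminus\{x\}\in\mathcal F$; (IG2) as the exchange axiom above; (IG3) if $X\subseteq Y\subseteq Z$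 in $\mathcal F$, $e\notin Z$, $X\cup\{e\},Z\cup\{e\}\in\mathcal F$ then $Y\cup\{e\}\in\mathcal F$. $\Gamma(X)=\{x\in E\setminus X:X\cup\{x\}\in\mathcal F\}$. $X\sim Y$ iff $\Gamma(X)=\Gamma(Y)$; classes $[X]$ are flats; $\Phi$ the set of flats ordered by $[X]\le[Y]$ iff there is $Z\subseteq E\setminus Y$ with $Y\cup Z\in\mathcal F$ and $Y\cup Z\sim X$ (a lattice). For a flat $A=[X]$: $\Gamma(A)=\Gamma(X)$, $\xi(A)=\bigcup_{X'\sim X}X'$. $\mu(S)=[X]$ for $X$ inclusion-maximal feasible in $S$. Join $A\vee B=\mu(\xi(A)\cap\xi(B))$. A covector is $\alpha:E\to\{0,+,-,1\}$ such that for some flat $A=\mathrm{supp}(\alpha)$, $\alpha\in\{+,-\}$ on $\Gamma(A)$, $0$ on $\xi(A)$, $1$ elsewhere. Symbols ordered $0<+<1$, $0<-<1$. Covector product: with $C=\mathrm{supp}\,\alpha\vee\mathrm{supp}\,\beta$, $(\alpha\circ\beta)(e)=\beta(e)$ if $e\in\Gamma(C)\cup\xi(C)$ and $\beta(e)>\alpha(e)$; $\alpha(e)$ if $e\in\Gamma(C)\cup\xi(C)$ otherwise; $1$ otherwise. $S(\alpha,\beta)=\{e:\alpha(e)=-\beta(e)\in\{+,-\}\}$. Oriented interval greedoid: $(E,\mathcal F,\mathcal L)$ with $\mathcal L$ a set of covectors satisfying (OG1) $\mathrm{supp}:\mathcal L\to\Phi$ surjective; (OG2) $-\mathcal L=\mathcal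 L$; (OG3) closed under $\circ$; (OG4) if $\alpha,\beta\in\mathcal L$, $x\in S(\alpha,\beta)$, $(\alpha\circ\beta)(x)\ne1$, some $\gamma\in\mathcal L$ has $\gamma(x)=0$ and $\gamma(y)=(\alpha\circ\beta)(y)=(\beta\circ\alpha)(y)$ for all $y\notin S(\alpha,\beta)$ with $(\alpha\circ\beta)(y)\neq1$. *)

(* Defs.v *)
From HB Require Import structures.
From mathcomp Require Import all_boot.

Set Implicit Arguments.
Unset Strict Implicit.
Unset Printing Implicit Defensive.

(** * Symbols *)

Inductive sign := Zero | Plus | Minus.

Definition option_of_sign (s : sign) : option bool :=
  match s with Zero => None | Plus => Some true | Minus => Some false end.
Definition sign_of_option (o : option bool) : sign :=
  match o with None => Zero | Some true => Plus | Some false => Minus end.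
Lemma option_of_signK : cancel option_of_sign sign_of_option.
Proof. by case. Qed.
HB.instance Definition _ := Finite.copy sign (can_type option_of_signK).

Definition opp_sign (s : sign) : sign :=
  match s with Zero => Zero | Plus => Minus | Minus => Plus end.

(** [symbol] is {0,+,-,1}: [Some] is the inclusion of {0,+,-} and [None] is the
    symbol 1, which is its own opposite. *)
Definition symbol : finType := option sign.

Definition opp_symbol (s : symbol) : symbol := omap opp_sign s.

Definition is_pm (s : symbol) : bool :=
  (s == Some Plus) || (s == Some Minus).

(** The strict partial order generated by 0 < + < 1 and 0 < - < 1. *)
Definition lt_symbol (s t : symbol) : bool :=
  match s, t with
  | Some Zero, Some Plus | Some Zero, Some Minus => true
  | Some _, None => true
  | _, _ => false
  end.

Definition symbols_of_signs (E : finType) (a : {ffun E -> sign}) :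
  {ffun E -> symbol} := [ffun e => Some (a e)].

(** * Matroids *)

Definition exchange (E : finType) (F : {set {set E}}) : Prop :=
  forall X Y : {set E}, X \in F -> Y \in F -> #|Y| < #|X| ->
    exists2 x, x \in X :\: Y & x |: Y \in F.

Record matroid (E : finType) (F : {set {set E}}) : Prop := Matroid {
  matroid_nonempty : F != set0;
  matroid_hereditary : forall X Y : {set E}, Y \subset X -> X \in F -> Y \in F;
  matroid_exchange : exchange F
}.

Definition loopless (E : finType) (F : {set {set E}}) : Prop :=
  forall e : E, [set e] \in F.

Definition rank (E : finType) (F : {set {set E}}) (S : {set E}) : nat :=
  \max_(X in F | X \subset S) #|X|.

Definition matroid_closed (E : finType) (F : {set {set E}}) (S : {set E}) :
  Prop := forall e, e \notin S -> rank F S < rank F (e |: S).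

(** * Oriented matroids *)

Definition om_opp (E : finType) (a : {ffun E -> sign}) : {ffun E -> sign} :=
  [ffun e => opp_sign (a e)].

Definition om_comp (E : finType) (a b : {ffun E -> sign}) :
  {ffun E -> sign} := [ffun e => if a e != Zero then a e else b e].

Definition om_sep (E : finType) (a b : {ffun E -> sign}) : {set E} :=
  [set e | (a e == opp_sign (b e)) && (a e != Zero)].

Record oriented_matroid (E : finType) (M : {set {ffun E -> sign}}) : Prop :=
  OrientedMatroid {
  OM1 : [ffun=> Zero] \in M;
  OM2 : forall a, a \in M -> om_opp a \in M;
  OM3 : forall a b, a \in M -> b \in M -> om_comp a b \in M;
  OM4 : forall a b e, a \in M -> b \in M -> e \in om_sep a b ->
    exists g, [/\ g \in M, g e = Zero &
      forall f, f \notin om_sep a b ->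
        g f = om_comp a b f /\ om_comp a b f = om_comp b a f]
}.

Definition zero_set (E : finType) (a : {ffun E -> sign}) : {set E} :=
  [set e | a e == Zero].

Definition has_underlying_matroid (E : finType) (M : {set {ffun E -> sign}})
  (F : {set {set E}}) : Prop :=
  forall S : {set E},
    matroid_closed F S <-> exists2 a, a \in M & zero_set a = S.

(** * Interval greedoids *)

Record interval_greedoid (E : finType) (F : {set {set E}}) : Prop :=
  IntervalGreedoid {
  IG_nonempty : F != set0;
  IG1 : forall X : {set E}, X \in F -> X != set0 ->
    exists2 x, x \in X & X :\ x \in F;
  IG2 : exchange F;
  IG3 : forall (X Y Z : {set E}) (e : E), X \in F -> Y \in F -> Z \in F ->
    X \subset Y -> Y \subset Z -> e \notin Z ->
    e |: X \in F -> e |: Z \in F -> e |: Y \in F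
}.

Definition Gamma (E : finType) (F : {set {set E}}) (X : {set E}) : {set E} :=
  [set x | (x \notin X) && (x |: X \in F)].

(** A flat is represented by the set of feasible sets that belong to it. *)
Definition flat_of (E : finType) (F : {set {set E}}) (X : {set E}) :
  {set {set E}} := [set Y in F | Gamma F Y == Gamma F X].

Definition flats (E : finType) (F : {set {set E}}) : {set {set {set E}}} :=
  [set flat_of F X | X in F].

(** All members of a flat have the same [Gamma], so this union is the common
    value. *)
Definition flat_Gamma (E : finType) (F : {set {set E}}) (A : {set {set E}}) :
  {set E} := \bigcup_(X in A) Gamma F X.

Definition xi (E : finType) (A : {set {set E}}) : {set E} :=
  \bigcup_(X in A) X.

(** In an interval greedoid the flat of a maximal feasible subset of [S] does
    not depend on the subset that is picked; one exists because the empty set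
    is feasible, so the default value is never used. *)
Definition mu (E : finType) (F : {set {set E}}) (S : {set E}) :
  {set {set E}} :=
  flat_of F (odflt set0
    [pick X | maxset [pred Y | (Y \in F) && (Y \subset S)] X]).

Definition join_flat (E : finType) (F : {set {set E}})
  (A B : {set {set E}}) : {set {set E}} := mu F (xi A :&: xi B).

(** * Covectors *)

Definition is_supp (E : finType) (F : {set {set E}})
  (a : {ffun E -> symbol}) (A : {set {set E}}) : bool :=
  [&& A \in flats F,
      [forall e in flat_Gamma F A, is_pm (a e)],
      [forall e in xi A, a e == Some Zero] &
      [forall e, (e \notin flat_Gamma F A :|: xi A) ==> (a e == None)]].

Definition covector (E : finType) (F : {set {set E}})
  (a : {ffun E -> symbol}) : Prop := exists A, is_supp F a A.

(** The default value is used only when [a] is not a covector. *)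
Definition supp (E : finType) (F : {set {set E}})
  (a : {ffun E -> symbol}) : {set {set E}} :=
  odflt set0 [pick A | is_supp F a A].

Definition cov_opp (E : finType) (a : {ffun E -> symbol}) :
  {ffun E -> symbol} := [ffun e => opp_symbol (a e)].

Definition cov_comp (E : finType) (F : {set {set E}})
  (a b : {ffun E -> symbol}) : {ffun E -> symbol} :=
  let C := join_flat F (supp F a) (supp F b) in
  [ffun e => if e \in flat_Gamma F C :|: xi C
             then if lt_symbol (a e) (b e) then b e else a e
             else None].

Definition cov_sep (E : finType) (a b : {ffun E -> symbol}) : {set E} :=
  [set e | (a e == opp_symbol (b e)) && is_pm (a e)].

Lemma Gamma_cst (E : finType) (F : {set {set E}}) (X : {set E}) :
  X \in F -> flat_Gamma F (flat_of F X) = Gamma F X.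
Proof.
move=> XF; apply/setP=> e; apply/bigcupP/idP => [[Y]|eX].
  by rewrite inE => /andP[_ /eqP->].
by exists X; rewrite // inE XF eqxx.
Qed.

(** A covector has exactly one support, so [supp] is well defined. *)
Lemma is_supp_inj (E : finType) (F : {set {set E}}) (A B : {set {set E}})
  (a : {ffun E -> symbol}) : is_supp F a A -> is_supp F a B -> A = B.
Proof.
have key D : is_supp F a D -> flat_Gamma F D = [set e | is_pm (a e)].
  case/and4P=> _ /forall_inP h1 /forall_inP h2 /forallP h3.
  apply/setP=> e; rewrite inE; apply/idP/idP; first exact: h1.
  move=> ae; apply/negPn/negP=> eG.
  have := h3 e; rewrite inE negb_or eG /=.
  have [/h2/eqP ex _|_ /eqP ex] := boolP (e \in xi D);
    by rewrite ex in ae.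
move=> hA hB; have := etrans (key A hA) (esym (key B hB)).
case/and4P: hA => /imsetP[X XF ->] _ _ _.
case/and4P: hB => /imsetP[Y YF ->] _ _ _.
rewrite !Gamma_cst // => eXY.
by apply/setP=> Z; rewrite !inE eXY.
Qed.

Lemma supp_eq (E : finType) (F A : {set {set E}}) (a : {ffun E -> symbol}) :
  is_supp F a A -> supp F a = A.
Proof.
move=> hA; rewrite /supp; case: pickP => [B hB|/(_ A)]; last by rewrite hA.
exact: is_supp_inj hB hA.
Qed.

(** * Oriented interval greedoids *)

Record oriented_interval_greedoid (E : finType) (F : {set {set E}})
  (L : {set {ffun E -> symbol}}) : Prop := OrientedIntervalGreedoid {
  OG_greedoid : interval_greedoid F;
  OG_covectors : forall a, a \in L -> covector F a;
  OG1 : forall A, A \in flats F -> exists2 a, a \in L & supp F a = A;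
  OG2 : [set cov_opp a | a in L] = L;
  OG3 : forall a b, a \in L -> b \in L -> cov_comp F a b \in L;
  OG4 : forall a b x, a \in L -> b \in L -> x \in cov_sep a b ->
    cov_comp F a b x != None ->
    exists g, [/\ g \in L, g x = Some Zero &
      forall y, y \notin cov_sep a b -> cov_comp F a b y != None ->
        g y = cov_comp F a b y /\ cov_comp F a b y = cov_comp F b a y]
}.

(* Main.v *)
Require Import Defs.
From mathcomp Require Import all_boot.

(** For an independent set [X] of a matroid, [Gamma F X] is the complement of
    the closure of [X].  Without loops every element of the closure lies in a
    basis of it, so [xi] of the flat of [X] is the whole closure.  Hence [xi] is
    a bijection from flats to matroid-closed sets, the symbol 1 never occurs in
    a covector or in a product of covectors, and (OG1)-(OG4) become the
    oriented matroid axioms together with the condition on zero sets. *)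

Set Implicit Arguments.
Unset Strict Implicit.
Unset Printing Implicit Defensive.

Section Matroid.

Variables (E : finType) (F : {set {set E}}).
Hypothesis matF : matroid F.

Implicit Types (X Y S : {set E}) (A B : {set {set E}}) (e : E).
Implicit Types (a b : {ffun E -> sign}).

Lemma matroid_set0 : set0 \in F.
Proof.
have [X XF] := set0Pn _ (matroid_nonempty matF).
exact: matroid_hereditary matF _ _ (sub0set X) XF.
Qed.

Lemma matroid_interval_greedoid : interval_greedoid F.
Proof.
split; first exact: matroid_nonempty matF.
- move=> X XF /set0Pn[x xX]; exists x => //.
  exact: matroid_hereditary matF _ _ (subsetDl _ _) XF.
- exact: matroid_exchange matF.
- move=> X Y Z e _ _ _ _ YZ _ _ eZ.
  exact: matroid_hereditary matF _ _ (setUS _ YZ) eZ.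
Qed.

Lemma sub_setC_Gamma X : X \subset ~: Gamma F X.
Proof. by apply/subsetP=> x xX; rewrite !inE xX. Qed.

(** If [Y] were larger, exchange would extend [X] by an element of [Y], which would then lie in
    [Gamma F X]. *)
Lemma leq_card_setC_Gamma X Y :
  X \in F -> Y \in F -> Y \subset ~: Gamma F X -> #|Y| <= #|X|.
Proof.
move=> XF YF /subsetP YX; rewrite leqNgt; apply/negP => ltXY.
have [x /setDP[xY xX] xXF] := matroid_exchange matF YF XF ltXY.
by have := YX x xY; rewrite !inE xX xXF.
Qed.

(** For [z] in [Gamma F X], exchange extends [Y] by an element of [z |: X]; elements of [X] cannot
    extend [Y], so it is [z]. *)
Lemma Gamma_sub X Y : X \in F -> Y \in F -> #|Y| <= #|X| ->
  X \subset ~: Gamma F Y -> Gamma F X \subset Gamma F Y.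
Proof.
move=> XF YF leYX /subsetP XY; apply/subsetP=> z; rewrite inE => /andP[zX zXF].
have ltY : #|Y| < #|z |: X| by rewrite cardsU1 zX.
have [w /setDP[wzX wY] wYF] := matroid_exchange matF zXF YF ltY.
have wG : w \in Gamma F Y by rewrite inE wY.
case/setU1P: wzX => [<- //|/XY]; by rewrite inE wG.
Qed.

Lemma rank_setC_Gamma X : X \in F -> rank F (~: Gamma F X) = #|X|.
Proof.
move=> XF; apply/eqP; rewrite eqn_leq; apply/andP; split.
  by apply/bigmax_leqP=> Y /andP[YF YX]; apply: leq_card_setC_Gamma.
by apply: (bigmax_sup X) => //; rewrite XF sub_setC_Gamma.
Qed.

Lemma matroid_closed_setC_Gamma X :
  X \in F -> matroid_closed F (~: Gamma F X).
Proof.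
move=> XF e; rewrite rank_setC_Gamma // inE negbK inE => /andP[eX eXF].
have -> : #|X|.+1 = #|e |: X| by rewrite cardsU1 eX.
by apply: (bigmax_sup (e |: X)) => //; rewrite eXF setUS ?sub_setC_Gamma.
Qed.

Lemma matroid_closedP S :
  matroid_closed F S <-> exists2 X, X \in F & S = ~: Gamma F X.
Proof.
split=> [clS|[X XF ->]]; last exact: matroid_closed_setC_Gamma.
(* The required [X] is a basis of [S]: an independent subset of maximum size. *)
have P0 : (set0 \in F) && (set0 \subset S) by rewrite matroid_set0 sub0set.
case: (@arg_maxnP _ set0 (fun X => (X \in F) && (X \subset S))
  (fun X => #|X|) P0).
move=> X /andP[XF XS] maxX; exists X => //.
have SG e : e \in S -> e \notin Gamma F X.
  move=> eS; rewrite inE; apply/negP=> /andP[eX eXF].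
  have := maxX (e |: X); rewrite eXF subUset sub1set eS XS => /(_ isT).
  by rewrite cardsU1 eX add1n /= ltnn.
apply/setP=> e; rewrite in_setC; apply/idP/idP=> [/SG //|].
(* An [e] outside both [S] and [Gamma F X] would leave the rank of [S] unchanged when added,
   contradicting closedness. *)
apply: contraR => eS; have := clS e eS; rewrite ltnNge; apply: contraR => eG.
have leX : #|X| <= rank F S by apply: (bigmax_sup X); rewrite ?XF.
apply: leq_trans leX; apply/bigmax_leqP=> Y /andP[YF YeS].
apply: leq_card_setC_Gamma => //; apply/subsetP=> y /(subsetP YeS).
by rewrite in_setC => /setU1P[->|/SG].
Qed.

(** Here [Gamma] and [xi] partition [E], so the clause for the symbol 1 is vacuous and the other two
    fix where [a] vanishes. *)
Lemma is_supp_flatP a X : X \in F -> xi (flat_of F X) = ~: Gamma F X ->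
  is_supp F (symbols_of_signs a) (flat_of F X) = (zero_set a == ~: Gamma F X).
Proof.
move=> XF xiX; rewrite /is_supp Gamma_cst // xiX imset_f //=.
apply/and3P/eqP => [[/forall_inP aG /forall_inP aX _]|za].
  apply/setP=> e; rewrite in_setC inE; apply/eqP/idP => [ae|eG].
    by apply/negP=> /aG; rewrite ffunE ae.
  by have := aX e; rewrite in_setC ffunE => /(_ eG)/eqP[].
split; last by apply/forallP=> e; rewrite !inE orbN.
  apply/forall_inP=> e eG; have : e \notin zero_set a by rewrite za inE eG.
  by rewrite inE ffunE; case: (a e).
by apply/forall_inP=> e; rewrite -za inE ffunE => /eqP->.
Qed.

Section Loopless.

Hypothesis loopF : loopless F.

Lemma xi_flat_of X : X \in F -> xi (flat_of F X) = ~: Gamma F X.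
Proof.
move=> XF; apply/setP=> e; rewrite in_setC; apply/bigcupP/idP => [[Y]|eG].
  by rewrite !inE => /andP[_ /eqP/setP/(_ e)]; rewrite !inE => <- ->.
(* The member of the flat through [e] is found by growing [[set e]], independent since there are no
   loops, inside [e |: X]. *)
have P0 : [&& [set e] \in F, e \in [set e] & [set e] \subset e |: X].
  by rewrite loopF set11 subsetUl.
case: (@arg_maxnP _ [set e]
  (fun Y => [&& Y \in F, e \in Y & Y \subset e |: X]) (fun Y => #|Y|) P0).
move=> Y /and3P[YF eY YeX] maxY; exists Y => //; rewrite inE YF /=.
have YX : Y \subset ~: Gamma F X.
  apply/subsetP=> y /(subsetP YeX)/setU1P[->|]; first by rewrite in_setC.
  exact/subsetP/sub_setC_Gamma.
have XY : X \subset ~: Gamma F Y.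
  apply/subsetP=> x xX; rewrite !inE; apply/negP=> /andP[xY xYF].
  have := maxY (x |: Y); rewrite xYF !inE eY orbT subUset sub1set YeX.
  by rewrite !inE xX orbT => /(_ isT); rewrite cardsU1 xY add1n /= ltnn.
(* Each of [X] and [Y] lies in the closure of the other, so their sizes agree and [Gamma_sub]
   applies both ways. *)
by rewrite eqEsubset !Gamma_sub ?leq_card_setC_Gamma.
Qed.

Lemma covector_symbolsP a :
  covector F (symbols_of_signs a) <-> matroid_closed F (zero_set a).
Proof.
split=> [[A sA]|/matroid_closedP[X XF za]].
  have /and4P[/imsetP[X XF eA] _ _ _] := sA.
  by move: sA; rewrite eA is_supp_flatP ?xi_flat_of // => /eqP->;
    apply: matroid_closed_setC_Gamma.
by exists (flat_of F X); rewrite is_supp_flatP ?xi_flat_of // za.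
Qed.

Lemma supp_symbolsP a X : covector F (symbols_of_signs a) -> X \in F ->
  supp F (symbols_of_signs a) = flat_of F X <-> zero_set a = ~: Gamma F X.
Proof.
move=> [A sA] XF; split=> [|za].
  rewrite (supp_eq sA) => eA; move: sA.
  by rewrite eA is_supp_flatP ?xi_flat_of // => /eqP.
by apply: supp_eq; rewrite is_supp_flatP ?xi_flat_of // za.
Qed.

Lemma mu_flat S : mu F S \in flats F.
Proof.
(* The default [set0] is feasible too, so both outcomes of [pick] give a flat. *)
rewrite /mu; apply: imset_f; case: pickP => [X|_] /=; last exact: matroid_set0.
by case/maxsetP=> /andP[].
Qed.

Lemma flat_Gamma_xi A : A \in flats F -> flat_Gamma F A :|: xi A = setT.
Proof. by case/imsetP=> X XF ->; rewrite Gamma_cst // xi_flat_of // setUCr. Qed.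

(** [Gamma] and [xi] of the join cover [E], so the value 1 is never taken; among signs, [b e]
    exceeds [a e] only when [a e] is [Zero]. *)
Lemma cov_comp_symbols a b :
  cov_comp F (symbols_of_signs a) (symbols_of_signs b) =
  symbols_of_signs (om_comp a b).
Proof.
apply/ffunP=> e; rewrite !ffunE flat_Gamma_xi ?mu_flat // in_setT.
by case: (a e); case: (b e).
Qed.

End Loopless.

End Matroid.

Section Symbols.

Variable E : finType.
Implicit Types (a b : {ffun E -> sign}) (L : {set {ffun E -> sign}}).

Lemma symbols_of_signsE a e : symbols_of_signs a e = Some (a e).
Proof. exact: ffunE. Qed.

Lemma symbols_of_signs_inj : injective (@symbols_of_signs E).
Proof.
by move=> a b /ffunP ab; apply/ffunP=> e; have := ab e; rewrite !ffunE => -[].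
Qed.

Lemma mem_symbols a L :
  (symbols_of_signs a \in [set symbols_of_signs b | b in L]) = (a \in L).
Proof. exact: mem_imset symbols_of_signs_inj. Qed.

Lemma cov_opp_symbols a :
  cov_opp (symbols_of_signs a) = symbols_of_signs (om_opp a).
Proof. by apply/ffunP=> e; rewrite !ffunE. Qed.

Lemma om_oppK : involutive (@om_opp E).
Proof. by move=> a; apply/ffunP=> e; rewrite !ffunE; case: (a e). Qed.

Lemma cov_sep_symbols a b :
  cov_sep (symbols_of_signs a) (symbols_of_signs b) = om_sep a b.
Proof. by apply/setP=> e; rewrite !inE !ffunE; case: (a e); case: (b e). Qed.

End Symbols.

Theorem mainTheorem5 (E : finType) (F : {set {set E}})
  (hF : matroid F) (hloop : loopless F) (L : {set {ffun E -> sign}}) :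
  oriented_matroid L /\ has_underlying_matroid L F <->
  oriented_interval_greedoid F [set symbols_of_signs a | a in L].
Proof.
split=> [[[_ omN omC omE] um]|[_ covL suppL ogN ogC ogE]].
- have covL a : a \in L -> covector F (symbols_of_signs a).
    by move=> aL; apply/covector_symbolsP => //; apply/um; exists a.
  split; first exact: matroid_interval_greedoid.
  + by move=> _ /imsetP[a aL ->]; apply: covL.
  + move=> _ /imsetP[X XF ->].
    (* The closure of [X] is the zero set of some [a] in [L], and this zero set determines the
       support. *)
    have /um[a aL za] := matroid_closed_setC_Gamma hF XF.
    exists (symbols_of_signs a); first by rewrite mem_symbols.
    by apply/supp_symbolsP => //; apply: covL.
  + apply/setP=> s; apply/imsetP/imsetP => [[_ /imsetP[a aL ->] ->]|[a aL ->]].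
      by exists (om_opp a); rewrite ?cov_opp_symbols // omN.
    exists (symbols_of_signs (om_opp a)); first by rewrite mem_symbols omN.
    by rewrite cov_opp_symbols om_oppK.
  + move=> _ _ /imsetP[a aL ->] /imsetP[b bL ->].
    by rewrite cov_comp_symbols // mem_symbols omC.
  + move=> _ _ x /imsetP[a aL ->] /imsetP[b bL ->].
    rewrite cov_sep_symbols => xab _; have [g [gL gx gE]] := omE a b x aL bL xab.
    exists (symbols_of_signs g); rewrite mem_symbols symbols_of_signsE gx; split=> // y yab _.
    by rewrite !cov_comp_symbols // !symbols_of_signsE; have [-> ->] := gE y yab.
- have {}covL a : a \in L -> covector F (symbols_of_signs a).
    by rewrite -mem_symbols => /covL.
  have um : has_underlying_matroid L F.
    move=> S; split=> [/(matroid_closedP hF)[X XF ->]|[a aL <-]].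
      (* Surjectivity of the support realizes every closed set as a zero set. *)
      have [_ /imsetP[a aL ->] /(supp_symbolsP hF hloop (covL a aL) XF) za] :=
        suppL _ (imset_f (flat_of F) XF).
      by exists a.
    by apply/covector_symbolsP/covL.
  split=> //; split.
  (* The zero map comes from the ground set, which is vacuously closed. *)
  + have /um[a aL /setP za] : matroid_closed F setT by move=> e; rewrite inE.
    suff <- : a = [ffun=> Zero] by [].
    by apply/ffunP=> e; have := za e; rewrite !inE ffunE => /eqP.
  + move=> a aL; rewrite -mem_symbols -cov_opp_symbols -ogN.
    by rewrite imset_f // mem_symbols.
  + move=> a b aL bL; rewrite -mem_symbols -(cov_comp_symbols hF hloop).
    by rewrite ogC ?mem_symbols.
  + move=> a b x aL bL xab.
    have [||||_ [/imsetP[g gL ->] gx gE]] :=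
      ogE (symbols_of_signs a) (symbols_of_signs b) x;
      rewrite ?mem_symbols ?cov_sep_symbols ?cov_comp_symbols //.
      (* The remaining side condition: the product is a sign at [x], hence not 1. *)
      by rewrite ffunE.
    exists g; split=> // [|y yab]; first by move: gx; rewrite ffunE => -[].
    have := gE y; rewrite cov_sep_symbols !cov_comp_symbols // => /(_ yab).
    by rewrite !symbols_of_signsE => /(_ isT)[[-> [->]]].
Qed.
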